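(* Let Fine's function be defined by $F(a,b;t):=\sum_{n=0}^{\infty}\frac{(a q)_n}{(b q)_n}t^n$. Let $N\in\mathbb{N}$. Then for $|q|<1$, $|c|<1/|q|$, $c\neq q^{-n}$, $0\leq n\leq N$, \begin{align*} & \frac{1}{(q)_N}\sum_{n = 1}^{N} \genfrac{[}{]}{0pt}{}{N}{n}\frac{(-1)^{n - 1}nq^{n(n + 1)/2}}{1 - cq^n} + \sum_{n = 1}^{N}\genfrac{[}{]}{0pt}{}{N}{n} \frac{q^{n(n + 1)}}{(q)_n (1 - q^n)} F\left(q^N, q^n; cq^n\right) \\ & = \ \frac{c}{(1 - c)^2 (q)_N}\left(\frac{(q)_N}{(cq)_N} - 1\right) + \frac{1}{(c)_{N+1}}\sum_{n = 1}^{N}\frac{(cq)_n}{(q)_n}\frac{q^n}{1 - q^n}. \end{align*}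
   Context: Here $(A)_n=(A;q)_n=(1-A)(1-Aq)\cdots(1-Aq^{n-1})$ with $(A)_0=1$, and $\genfrac{[}{]}{0pt}{}{N}{n}=\frac{(q;q)_N}{(q;q)_n(q;q)_{N-n}}$ for $0\le n\le N$ is the $q$-binomial coefficient. *)

(* Defs.v *)
From mathcomp Require Import all_boot all_order all_algebra.
From mathcomp Require Import all_classical all_reals all_analysis.

Set Implicit Arguments.
Unset Strict Implicit.
Unset Printing Implicit Defensive.

Import Order.TTheory GRing.Theory Num.Theory.
Import numFieldNormedType.Exports.

Local Open Scope ring_scope.
Local Open Scope classical_set_scope.

(* These are stated over a numFieldType because the norm topology is inferred
   from that structure and not from the head symbol of R[i]. *)
Section QSeries.
Variable K : numFieldType.
Implicit Types (q a b t A : K) (n N : nat).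

Definition qpoch q A n : K := \prod_(0 <= k < n) (1 - A * q ^+ k).

(* Meaningful only for n <= N: N - n is truncated subtraction. *)
Definition qbinom q N n : K :=
  qpoch q q N / (qpoch q q n * qpoch q q (N - n)).

Definition fineF q a b t : K :=
  limn (series (fun n => qpoch q (a * q) n / qpoch q (b * q) n * t ^+ n)).

End QSeries.

(* Main.v *)
(** For [n <= N] the ratio [(q^(N+1))_m / (q^(n+1))_m] is a polynomial in [q^m],
    so expanding it by the finite [q]-binomial theorem and summing geometric
    series turns [F(q^N, q^n; c q^n)] into a finite sum over [j] of multiples of
    [1 / (1 - c q^(n+j))].  Collecting the terms with [k = n + j], the inner sum
    over [n] is Van Hamme's
      [sum_n [k, n] (-1)^(n-1) q^(n(n+1)/2) / (1 - q^n) = sum_(n <= k) q^n / (1 - q^n)],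
    so the left-hand side is [1 / (q)_N] times
      [- sum_k [N, k] (-1)^k q^(k(k+1)/2) U_k / (1 - c q^k)],
    where [U_k = sum_(i <= k) 1 / (1 - q^i)].  From
    [1 - c q^N = (1 - q^(N-k)) + q^(N-k) (1 - c q^k)] both this sum and [(q)_N]
    times the right-hand side, as functions [L_N] of [N], satisfy
      [(1 - c q^N) L_N = (1 - q^N) L_(N-1) + q^N / (1 - q^N)]. *)
Require Import Defs.
From mathcomp Require Import all_boot all_order all_algebra.
From mathcomp Require Import complex ring zify.
From mathcomp Require Import all_classical all_reals all_analysis.

Import Order.TTheory GRing.Theory Num.Theory.
Import numFieldNormedType.Exports.

Local Open Scope ring_scope.
Local Open Scope complex_scope.
Local Open Scope classical_set_scope.

Lemma bin2D m n : 'C(m + n, 2) = ('C(m, 2) + 'C(n, 2) + m * n)%N.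
Proof.
elim: n => [|n IHn]; first by rewrite addn0 muln0 !addn0.
by rewrite addnS !binS !bin1 IHn mulnS; lia.
Qed.

Lemma muln_bin2 n : (n * n.+1 = 2 * 'C(n.+1, 2))%N.
Proof. by elim: n => // n IHn; rewrite binS bin1 mulnDr -IHn; lia. Qed.

(** * Gaussian binomials and the finite q-binomial theorem *)

Section GaussianBinomials.
Variables (K : numFieldType) (q : K).
Implicit Types (c z A : K) (f : nat -> K) (k n m N : nat).

Lemma qpoch0 A : qpoch q A 0 = 1.
Proof. by rewrite /qpoch big_geq. Qed.

Lemma qpochS A n : qpoch q A n.+1 = qpoch q A n * (1 - A * q ^+ n).
Proof. by rewrite /qpoch big_nat_recr. Qed.

Lemma qpochD A m n : qpoch q A (m + n) = qpoch q A m * qpoch q (A * q ^+ m) n.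
Proof.
elim: n => [|n IHn]; first by rewrite addn0 qpoch0 mulr1.
by rewrite addnS !qpochS IHn -mulrA -(mulrA A) -exprD.
Qed.

Lemma qpochSl A n : qpoch q A n.+1 = (1 - A) * qpoch q (A * q) n.
Proof. by rewrite -add1n qpochD qpochS qpoch0 expr0 expr1 mul1r mulr1. Qed.

Lemma qpoch_neq0 A n :
  (forall k, (k < n)%N -> 1 - A * q ^+ k != 0) -> qpoch q A n != 0.
Proof.
elim: n => [|n IHn] nzA; first by rewrite qpoch0 oner_eq0.
by rewrite qpochS mulf_neq0 ?nzA ?IHn // => k ltkn; rewrite nzA // ltnW.
Qed.

(** The q-Pascal recursion avoids division and gives 0 for [k > N], where [qbinom] takes a junk
    value; sums over [k] can thus be extended past [N]. *)
Fixpoint gauss N k : K :=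
  match N, k with
  | _, 0 => 1
  | 0, _.+1 => 0
  | N'.+1, k'.+1 => gauss N' k' + q ^+ k'.+1 * gauss N' k'.+1
  end.

Lemma gaussn0 N : gauss N 0 = 1.
Proof. by case: N. Qed.

Lemma gauss_small N k : (N < k)%N -> gauss N k = 0.
Proof.
elim: N k => [|N IHN] [|k] //= ltNk.
by rewrite !IHN ?mulr0 ?addr0 // ltnW.
Qed.

Lemma gaussSl N k :
  gauss N.+1 k.+1 = gauss N k + q ^+ k.+1 * gauss N k.+1.
Proof. by []. Qed.

Arguments gauss : simpl never.

(** Induction along the Pascal recursion, splitting [1 - x * y] as [(1 - x) + x * (1 - y)]; no
    division occurs, so [q] is still arbitrary. *)
Lemma gauss_fact N k : (k <= N)%N ->
  gauss N k * (qpoch q q k * qpoch q q (N - k)) = qpoch q q N.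
Proof.
elim: N k => [|N IHN] [|k] // lekN; first by rewrite gaussn0 qpoch0 !mul1r.
  by rewrite gaussn0 qpoch0 subn0 !mul1r.
rewrite subSS gaussSl (qpochS q N) (qpochS q k) -!exprS.
have Hk := IHN k lekN.
(* The case [k = N] is separate because [N - k.+1] truncates there. *)
have [ltkN|] := ltnP k N; last first.
  move=> leNk; have ekN : k = N by apply/eqP; rewrite eqn_leq leNk andbT.
  by rewrite -Hk ekN subnn (gauss_small _ N.+1) //; ring.
have Hk1 := IHN k.+1 ltkN.
have eNk : (N - k = (N - k.+1).+1)%N by lia.
have eqN : q ^+ N.+1 = q ^+ k.+1 * q ^+ (N - k.+1).+1.
  by rewrite -exprD; congr (_ ^+ _); lia.
move: Hk Hk1; rewrite eNk !(qpochS q (N - k.+1)) (qpochS q k) -!exprS eqN.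
move: (gauss N k) (gauss N k.+1) (qpoch q q k) (qpoch q q (N - k.+1)).
move: (q ^+ k.+1) (q ^+ _.+1) => x y g g1 P Q Hk Hk1.
have -> : qpoch q q N * (1 - x * y) = qpoch q q N * (1 - x) + x * (1 - y) * qpoch q q N.
  by ring.
by rewrite -{1}Hk -Hk1; ring.
Qed.

Hypothesis q_nroot : forall n, 1 - q ^+ n.+1 != 0.

Lemma qpochqq_neq0 n : qpoch q q n != 0.
Proof. by apply: qpoch_neq0 => k _; rewrite -exprS. Qed.

Lemma qbinom_gauss N k : (k <= N)%N -> qbinom q N k = gauss N k.
Proof.
move=> lekN; rewrite /qbinom -(gauss_fact _ _ lekN) mulfK //.
by rewrite mulf_neq0 ?qpochqq_neq0.
Qed.

Lemma gauss_step N k : (k <= N)%N ->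
  gauss N k.+1 * (1 - q ^+ k.+1) = gauss N k * (1 - q ^+ (N - k)).
Proof.
rewrite leq_eqVlt => /predU1P[->|ltkN].
  by rewrite gauss_small // subnn expr0 subrr mul0r mulr0.
rewrite -!qbinom_gauss // ?[(k <= N)%N]ltnW // /qbinom.
have -> : (N - k = (N - k.+1).+1)%N by lia.
rewrite !(qpochS q) -!exprS.
by field; rewrite !qpochqq_neq0 !q_nroot.
Qed.

Lemma gaussS N k : (k <= N)%N ->
  gauss N.+1 k.+1 = gauss N k.+1 + q ^+ (N - k) * gauss N k.
Proof.
move=> /gauss_step H; rewrite gaussSl; apply/eqP; rewrite -subr_eq0; apply/eqP.
move: H; set x := q ^+ (N - k); set y := q ^+ k.+1 => H.
have -> : gauss N k + y * gauss N k.+1 - (gauss N k.+1 + x * gauss N k) =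
   gauss N k * (1 - x) - gauss N k.+1 * (1 - y) by ring.
by rewrite H subrr.
Qed.

Lemma gauss_absorb N k :
  gauss N.+1 k.+1 * (1 - q ^+ k.+1) = (1 - q ^+ N.+1) * gauss N k.
Proof.
have [ltNk|lekN] := ltnP N k.
  by rewrite !gauss_small ?mul0r ?mulr0.
rewrite -!qbinom_gauss // /qbinom subSS !(qpochS q) -!exprS.
by field; rewrite !qpochqq_neq0 !q_nroot.
Qed.

Lemma gauss_absorbr N k : (k <= N.+1)%N ->
  gauss N.+1 k * (1 - q ^+ (N.+1 - k)) = (1 - q ^+ N.+1) * gauss N k.
Proof.
case: k => [|k] lekN; first by rewrite !gaussn0 subn0 mul1r mulr1.
apply: (mulIf (q_nroot k)).
by rewrite subSS mulrAC gauss_absorb -!mulrA gauss_step.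
Qed.

(** Pascal's rule moved onto the weight [f]: the second index is shifted in [f] instead of in the
    coefficient. *)
Lemma gauss_sumS f N :
  \sum_(0 <= k < N.+2) gauss N.+1 k * f k =
  \sum_(0 <= k < N.+1) gauss N k * (q ^+ k * f k + f k.+1).
Proof.
under [RHS]eq_bigr do rewrite mulrDr.
rewrite big_split /= [in LHS]big_nat_recl // gaussn0.
under eq_bigr do rewrite gaussSl mulrDl.
rewrite big_split /= addrCA [RHS]addrC; congr (_ + _).
transitivity (\sum_(0 <= k < N.+2) gauss N k * (q ^+ k * f k)).
  rewrite [in RHS]big_nat_recl // gaussn0 expr0 !mul1r; congr (_ + _).
  by apply: eq_bigr => k _; rewrite mulrAC mulrA mulrC mulrA.
by rewrite big_nat_recr //= gauss_small // mul0r addr0.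
Qed.

Lemma exp_bin2S k : q ^+ 'C(k.+1, 2) = q ^+ 'C(k, 2) * q ^+ k.
Proof. by rewrite binS bin1 exprD. Qed.

(** The finite q-binomial theorem: the factor [1 - z] is split off and the induction hypothesis is
    used at [z * q], which [gauss_sumS] matches term by term. *)
Lemma qpoch_gauss z N : qpoch q z N =
  \sum_(0 <= k < N.+1) gauss N k * ((-1) ^+ k * q ^+ 'C(k, 2) * z ^+ k).
Proof.
elim: N z => [|N IHN] z.
  by rewrite qpoch0 big_nat1 gaussn0 !expr0 !mulr1.
rewrite qpochSl IHN gauss_sumS mulr_sumr; apply: eq_bigr => k _.
rewrite exp_bin2S exprMn !exprS.
move: (gauss _ _) ((-1) ^+ k) (q ^+ 'C(_, _)) => *.
by move: (z ^+ k) (q ^+ k) => *; ring.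
Qed.

(** * Partial-fraction sums in [c] and their recurrence in [N] *)

Lemma qpoch1_eq0 N : qpoch q 1 N.+1 = 0.
Proof. by rewrite qpochSl subrr mul0r. Qed.

Definition gsum c f N : K :=
  \sum_(0 <= k < N.+1)
    gauss N k * ((-1) ^+ k * q ^+ 'C(k.+1, 2) * f k / (1 - c * q ^+ k)).

(** Write [1 - c q^(N+1)] as [(1 - q^(N+1-k)) + q^(N+1-k) (1 - c q^k)]. The first part lowers [N] by
    absorption; the second cancels the denominator, leaving a sum free of [c]. *)
Lemma gsumS c f N : (forall k, (k <= N.+1)%N -> 1 - c * q ^+ k != 0) ->
  (1 - c * q ^+ N.+1) * gsum c f N.+1 =
  (1 - q ^+ N.+1) * gsum c f N + q ^+ N.+1 *
    \sum_(0 <= k < N.+2) gauss N.+1 k * ((-1) ^+ k * q ^+ 'C(k, 2) * f k).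
Proof.
move=> nzc.
have -> : gsum c f N = \sum_(0 <= k < N.+2)
    gauss N k * ((-1) ^+ k * q ^+ 'C(k.+1, 2) * f k / (1 - c * q ^+ k)).
  by rewrite [RHS]big_nat_recr //= gauss_small // mul0r addr0.
rewrite !mulr_sumr -big_split /=; apply: eq_big_nat => k /andP[_ lekN].
rewrite [(1 - q ^+ _) * _]mulrA -gauss_absorbr // exp_bin2S.
have -> : q ^+ N.+1 = q ^+ k * q ^+ (N.+1 - k) by rewrite -exprD subnKC.
move: (nzc k lekN) (gauss _ _) (f k); move: ((-1) ^+ k) (q ^+ (_ - _)).
by move: (q ^+ 'C(_, _)) (q ^+ k) => *; field.
Qed.

(** For [f = 1] the sum left over in [gsumS] is the q-binomial expansion of [(1)_(N+1) = 0], so the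
    recurrence is a pure product. *)
Lemma gsum1 c N : (forall k, (k <= N)%N -> 1 - c * q ^+ k != 0) ->
  gsum c (fun=> 1) N = qpoch q q N / qpoch q c N.+1.
Proof.
elim: N => [|N IHN] nzc.
  rewrite /gsum big_nat1 gaussn0 qpochS !qpoch0 bin_small //.
  by rewrite !expr0 !mul1r.
apply: (mulfI (nzc _ (leqnn _))).
rewrite gsumS // IHN; last by move=> k lekN; rewrite nzc // leqW.
have -> : \sum_(0 <= k < N.+2) gauss N.+1 k * ((-1) ^+ k * q ^+ 'C(k, 2) * 1) = 0.
  rewrite -[RHS](qpoch1_eq0 N) qpoch_gauss.
  by apply: eq_bigr => k _; rewrite expr1n.
rewrite mulr0 addr0 (qpochS q N) (qpochS c N.+1) -exprS.
have nzP : qpoch q c N.+1 != 0.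
  by apply: qpoch_neq0 => k ltkN; rewrite nzc // ltnW.
by field; rewrite nzP nzc.
Qed.

Definition qharm k : K := \sum_(1 <= i < k.+1) (1 - q ^+ i)^-1.

Lemma qharmS k : qharm k.+1 = qharm k + (1 - q ^+ k.+1)^-1.
Proof. by rewrite /qharm big_nat_recr. Qed.

(** After [gauss_sumS] only the differences [qharm k.+1 - qharm k] survive, and they form [- gsum]
    with [c = q], which [gsum1] evaluates. *)
Lemma gauss_sum_qharm N :
  \sum_(0 <= k < N.+2) gauss N.+1 k * ((-1) ^+ k * q ^+ 'C(k, 2) * qharm k) =
  - (1 - q ^+ N.+1)^-1.
Proof.
rewrite gauss_sumS.
have nzq k : 1 - q * q ^+ k != 0 by rewrite -exprS.
transitivity (- gsum q (fun=> 1) N).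
  rewrite /gsum -sumrN; apply: eq_bigr => k _.
  rewrite exp_bin2S qharmS -!exprS [(-1) ^+ k.+1]exprS.
  move: (q_nroot k) (gauss _ _) (qharm k); move: (q ^+ k.+1) ((-1) ^+ k).
  by move: (q ^+ 'C(_, _)) (q ^+ k) => *; field.
rewrite gsum1 // (qpochS q N) -exprS.
by congr (- _); field; rewrite qpochqq_neq0 q_nroot.
Qed.

(** Both sides vanish at [N = 0] and obey the same first-order recurrence, whose inhomogeneous term
    comes from [gauss_sum_qharm]. *)
Lemma gsum_qharm c N : (forall k, (k <= N)%N -> 1 - c * q ^+ k != 0) ->
  - gsum c qharm N =
  c / (1 - c) ^+ 2 * (qpoch q q N / qpoch q (c * q) N - 1) +
  qpoch q q N / qpoch q c N.+1 *
    \sum_(1 <= n < N.+1)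
      qpoch q (c * q) n / qpoch q q n * (q ^+ n / (1 - q ^+ n)).
Proof.
elim: N => [|N IHN] nzc.
  rewrite /gsum big_nat1 big_geq // /qharm big_geq //.
  by rewrite !qpoch0 divr1 subrr !mulr0 !mul0r !mulr0 addr0 oppr0.
have nzcN k : (k <= N)%N -> 1 - c * q ^+ k != 0.
  by move=> lekN; rewrite nzc // leqW.
apply: (mulfI (nzc _ (leqnn _))).
rewrite mulrN gsumS // gauss_sum_qharm opprD -mulrN IHN //.
rewrite [in RHS]big_nat_recr //=.
set S := \sum_(_ <= _ < _) _.
rewrite (qpochS q N) !(qpochSl c) (qpochS (c * q) N) -!exprS -!mulrA -!exprS.
have nzP : qpoch q (c * q) N != 0.
  by apply: qpoch_neq0 => k ltkN; rewrite -mulrA -exprS nzc // ltnW.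
have nz1 : 1 - c != 0 by have := nzc 0%N isT; rewrite expr0 mulr1.
move: (nzc _ (leqnn _)) (q_nroot N) nzP nz1 (qpochqq_neq0 N).
move: (qpoch q q N) (qpoch q _ N) (q ^+ N.+1) S => P Q x S n1 n2 n3 n4 n5.
by field; rewrite n1 n2 n3 n4 n5.
Qed.

(* Van Hamme's identity *)
Lemma gauss_sum_lambert N :
  \sum_(1 <= n < N.+1)
    gauss N n * ((-1) ^+ n * q ^+ 'C(n.+1, 2) / (1 - q ^+ n)) =
  - \sum_(1 <= n < N.+1) q ^+ n / (1 - q ^+ n).
Proof.
elim: N => [|N IHN]; first by rewrite !big_geq ?oppr0.
rewrite [in RHS]big_nat_recr //= opprD -IHN.
(* The other Pascal rule [gaussS] isolates the increment in [N]; absorption cancels [1 - q^n] in it,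
   leaving the factor [q^(N+1) / (1 - q^(N+1))], independent of [n]. The power [1 ^+ n] is kept to
   match [qpoch_gauss] at 1. *)
rewrite (eq_big_nat _ _ (F2 := fun n =>
    gauss N n * ((-1) ^+ n * q ^+ 'C(n.+1, 2) / (1 - q ^+ n)) +
    q ^+ N.+1 / (1 - q ^+ N.+1) *
      (gauss N.+1 n * ((-1) ^+ n * q ^+ 'C(n, 2) * 1 ^+ n)))); last first.
  case=> // n /andP[_ ltnN].
  rewrite [in LHS]gaussS // mulrDl; congr (_ + _).
  rewrite expr1n exp_bin2S; apply: (mulfI (q_nroot N)).
  move: (q_nroot n) (q_nroot N) (gauss_absorb N n).
  have -> : q ^+ N.+1 = q ^+ n.+1 * q ^+ (N - n).
    by rewrite -exprD; congr (_ ^+ _); lia.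
  move: (gauss N n) (gauss N.+1 n.+1) ((-1) ^+ n.+1) (q ^+ 'C(_, _)).
  move: (q ^+ n.+1) (q ^+ (N - n)) => x y g g' s w n1 n2 H.
  have -> : (1 - x * y) * (y * g * (s * (w * x) / (1 - x))) =
     ((1 - x * y) * g) * (y * (s * (w * x) / (1 - x))) by ring.
  by rewrite -H; field; rewrite n1 n2.
rewrite big_split /= -mulr_sumr; congr (_ + _).
  by rewrite big_nat_recr //= gauss_small // mul0r addr0.
(* The full alternating sum is 0, so the part from 1 on is minus the term at 0, that is -1. *)
have := qpoch_gauss 1 N.+1; rewrite qpoch1_eq0 big_ltn // gaussn0.
rewrite !expr0 !mul1r => /esym /eqP; rewrite addrC addr_eq0 => /eqP ->.
by rewrite mulrN1.
Qed.

(** * Collapsing the double sum *)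

Lemma sum_triangle (F : nat -> nat -> K) N :
  \sum_(1 <= n < N.+1) \sum_(0 <= j < (N - n).+1) F n (n + j)%N =
  \sum_(1 <= k < N.+1) \sum_(1 <= n < k.+1) F n k.
Proof.
elim: N => [|N IHN]; first by rewrite !big_geq.
rewrite [in RHS]big_nat_recr //= -IHN [in LHS]big_nat_recr //= subnn big_nat1.
rewrite addn0 [X in _ = _ + X]big_nat_recr //= addrA; congr (_ + _).
rewrite -big_split /=; apply: eq_big_nat => n /andP[_ lenN].
by rewrite subSn // big_nat_recr //= -subSn // subnKC // leqW.
Qed.

(** Both sides are the q-trinomial [(q)_N / ((q)_n (q)_j (q)_(N-n-j))]. *)
Lemma gauss_trinomial N n j : (n + j <= N)%N ->
  gauss N n * gauss (N - n) j = gauss N (n + j) * gauss (n + j) n.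
Proof.
move=> lenjN; rewrite -!qbinom_gauss ?/qbinom; try lia.
have -> : (n + j - n = j)%N by lia.
have -> : (N - n - j = N - (n + j))%N by lia.
by field; rewrite !qpochqq_neq0.
Qed.

(** From [1 / (1 - x) = 1 + x / (1 - x)]. The two summands correspond to the two sums on the
    left-hand side of the theorem. *)
Lemma qharmE k :
  qharm k = k%:R + \sum_(1 <= i < k.+1) q ^+ i / (1 - q ^+ i).
Proof.
elim: k => [|k IHk]; first by rewrite /qharm !big_geq ?addr0.
rewrite qharmS IHk [in RHS]big_nat_recr //= -natr1 -!addrA; congr (_ + _).
rewrite addrCA; congr (_ + _).
by move: (q_nroot k); move: (q ^+ k.+1) => x nz; field.
Qed.

(** Splitting [(q)_(N+m)] at [N] and at [n + m] trades products of length [m] for one of fixed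
    length [N - n], a polynomial in [q^m]. *)
Lemma qpoch_ratio N n m : (n <= N)%N ->
  qpoch q (q ^+ N * q) m / qpoch q (q ^+ n * q) m =
  qpoch q q n / qpoch q q N * qpoch q (q ^+ (n + m).+1) (N - n).
Proof.
move=> lenN; have nzP := qpochqq_neq0.
have EN := qpochD q N m; have En := qpochD q n m.
have EnN := qpochD q (n + m) (N - n).
have eNm : (n + m + (N - n) = N + m)%N by lia.
rewrite eNm EN En in EnN.
have nzn : qpoch q (q * q ^+ n) m != 0.
  by have := nzP (n + m)%N; rewrite En mulf_eq0 negb_or => /andP[].
rewrite -!exprSr !exprS; apply: (mulfI (nzP N)).
rewrite mulrA EnN.
by field; rewrite nzn !nzP.
Qed.

Lemma double_sum_gsum c N : (forall k, 1 - c * q ^+ k != 0) ->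
  \sum_(1 <= n < N.+1)
    gauss N n * (q ^+ (n * n.+1) / (1 - q ^+ n)) *
      (\sum_(0 <= j < (N - n).+1)
         gauss (N - n) j *
           ((-1) ^+ j * q ^+ 'C(j, 2) * q ^+ (n.+1 * j) / (1 - c * q ^+ (n + j)))) =
  - gsum c (fun k => \sum_(1 <= n < k.+1) q ^+ n / (1 - q ^+ n)) N.
Proof.
move=> nzc.
pose F n k := gauss N k * ((-1) ^+ k * q ^+ 'C(k.+1, 2) / (1 - c * q ^+ k)) *
  (gauss k n * ((-1) ^+ n * q ^+ 'C(n.+1, 2) / (1 - q ^+ n))).
transitivity (\sum_(1 <= n < N.+1) \sum_(0 <= j < (N - n).+1) F n (n + j)%N).
  apply: eq_big_nat => -[//|n] /andP[_ lenN].
  rewrite mulr_sumr; apply: eq_big_nat => j /andP[_ lejN].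
  have {lejN}lenjN : (n.+1 + j <= N)%N by lia.
  have H := gauss_trinomial _ _ _ lenjN.
  rewrite /F (mulrACA (gauss _ _)) [RHS]mulrACA -H; congr (_ * _).
  (* One half of this exponent completes the exponent in [k = n + j] through [bin2D]; the other
     half, with the sign [(-1)^n], supplies the weight in Van Hamme's sum. *)
  have -> : q ^+ (n.+1 * n.+2) = q ^+ 'C(n.+2, 2) * q ^+ 'C(n.+2, 2).
    by rewrite -exprD addnn -mul2n muln_bin2.
  have -> : q ^+ 'C((n.+1 + j).+1, 2) =
      q ^+ 'C(n.+2, 2) * q ^+ 'C(j, 2) * q ^+ (n.+2 * j).
    by rewrite -!exprD -bin2D.
  have -> : (-1) ^+ j = (-1) ^+ (n.+1 + j) * (-1) ^+ n.+1 :> K.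
    by rewrite [RHS]mulrC exprD signrMK.
  move: (q_nroot n) (nzc (n.+1 + j)%N).
  move: (q ^+ 'C(n.+2, 2)) (q ^+ 'C(j, 2)) (q ^+ (_ * _)) => u v w.
  move: ((-1) ^+ (_ + _)) ((-1) ^+ n.+1) => s t.
  move: (q ^+ n.+1) (q ^+ (_ + _)) => x y n1 n2.
  by field; rewrite n1 n2.
rewrite sum_triangle /gsum -sumrN [RHS]big_ltn //=.
rewrite [X in _ * X / _]big_geq //.
rewrite mulr0 mul0r mulr0 oppr0 add0r; apply: eq_bigr => k _.
rewrite /F -mulr_sumr gauss_sum_lambert mulrN.
by rewrite -(mulrA (gauss N k)) (mulrAC (_ * _)).
Qed.

End GaussianBinomials.

(** * Complex geometric series and the evaluation of F *)

Lemma subr_norm_neq0 (K : numFieldType) (z : K) : `|z| < 1 -> 1 - z != 0.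
Proof.
apply: contraTneq => /eqP; rewrite subr_eq0 => /eqP <-.
by rewrite normr1 ltxx.
Qed.

(* The archimedean [cvg_expr] does not apply to [R[i]]; convergence is pulled
   back to the real modulus. *)
Lemma cvg_exprC (R : realType) (z : R[i]) : `|z| < 1 ->
  (fun n => z ^+ n : (R[i] : numFieldType)) @ \oo --> (0 : (R[i] : numFieldType)).
Proof.
move=> z1; apply/cvgr0Pnorm_lt => e e0.
have [r r0 nz] : exists2 r : R, 0 <= r & `|z| = r%:C.
  exists (complex.Re `|z|); first by have := normr_ge0 z; rewrite lecE => /andP[].
  by rewrite RRe_real // normr_real.
have [d d0 ed] : exists2 d : R, 0 < d & e = d%:C.
  exists (complex.Re e); first by move: e0; rewrite ltcE => /andP[].
  by rewrite RRe_real // gtr0_real.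
have r1 : `|r| < 1 by rewrite ger0_norm // -ltcR -nz.
have /cvgr0Pnorm_lt /(_ d d0) := @cvg_expr _ _ r1.
apply: filterS => n /=.
by rewrite !normrX nz ed ger0_norm // -rmorphXn ltcR.
Qed.

Lemma cvg_geometric_seriesC (R : realType) (a z : R[i]) : `|z| < 1 ->
  series (geometric (a : (R[i] : numFieldType)) z) @ \oo -->
    (a / (1 - z) : (R[i] : numFieldType)).
Proof.
move=> z1; rewrite geometric_seriesE; last first.
  by rewrite eq_sym -subr_eq0 subr_norm_neq0.
have -> : a / (1 - z) = a * (1 - 0) / (1 - z) by rewrite subr0 mulr1.
apply: cvgMr_tmp; apply: cvgMl_tmp; apply: cvgB; first exact: cvg_cst.
exact: cvg_exprC.
Qed.

Lemma fineF_gauss (R : realType) (q c : R[i]) (N n : nat) :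
  `|q| < 1 -> `|c * q ^+ n| < 1 -> (n <= N)%N ->
  fineF q (q ^+ N) (q ^+ n) (c * q ^+ n) =
  qpoch q q n / qpoch q q N *
    \sum_(0 <= j < (N - n).+1)
      gauss _ q (N - n) j *
        ((-1) ^+ j * q ^+ 'C(j, 2) * q ^+ (n.+1 * j) / (1 - c * q ^+ (n + j))).
Proof.
move=> q1 cq1 lenN.
have nzq k : 1 - q ^+ k.+1 != 0.
  by rewrite subr_norm_neq0 // normrX exprn_ilt1.
pose a j := qpoch q q n / qpoch q q N *
  (gauss _ q (N - n) j * ((-1) ^+ j * q ^+ 'C(j, 2) * q ^+ (n.+1 * j))).
rewrite /fineF; apply: cvg_lim; first exact: norm_hausdorff.
(* The interchange is made in the partial sums, where both sums are finite; the limit then passes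
   through a sum of fixed length. *)
rewrite [X in X @ _ --> _](_ : _ = (fun M =>
  \sum_(0 <= j < (N - n).+1) series (geometric (a j) (c * q ^+ (n + j))) M)); last first.
  apply/funext => M; rewrite /series /= exchange_big /=.
  apply: eq_bigr => m _; rewrite qpoch_ratio // (qpoch_gauss _ q (q ^+ _.+1)) mulr_sumr mulr_suml.
  apply: eq_bigr => j _; rewrite /a -!mulrA; do 5 congr (_ * _).
  rewrite !exprMn [LHS]mulrCA [RHS]mulrCA; congr (_ * _).
  by rewrite -!exprM -!exprD; congr (_ ^+ _); nia.
rewrite mulr_sumr; apply: cvg_big => [|j _]; first exact: add_continuous.
rewrite [X in _ --> X](_ : _ = a j / (1 - c * q ^+ (n + j))); last first.
  by rewrite /a !mulrA.
apply: cvg_geometric_seriesC.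
rewrite exprD mulrA normrM (le_lt_trans _ cq1) // ler_piMr // normrX.
by rewrite exprn_ile1 // ltW.
Qed.

Theorem theorem1p4 (R : realType) (N : nat) (q c : R[i])
    (hq : `|q| < 1)
    (hc : q != 0 -> `|c| < 1 / `|q|)
    (hcq : forall n : nat, (n <= N)%N -> q ^+ n != 0 -> c != q ^- n) :
  1 / qpoch q q N *
    (\sum_(1 <= n < N.+1)
       qbinom q N n *
         ((-1) ^+ (n - 1) * n%:R * q ^+ (n * (n + 1) %/ 2) / (1 - c * q ^+ n)))
  + \sum_(1 <= n < N.+1)
      qbinom q N n * (q ^+ (n * (n + 1)) / (qpoch q q n * (1 - q ^+ n))) *
        fineF q (q ^+ N) (q ^+ n) (c * q ^+ n)
  = c / ((1 - c) ^+ 2 * qpoch q q N) * (qpoch q q N / qpoch q (c * q) N - 1)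
    + 1 / qpoch q c N.+1 *
        (\sum_(1 <= n < N.+1)
           qpoch q (c * q) n / qpoch q q n * (q ^+ n / (1 - q ^+ n))).
Proof.
have nzq k : 1 - q ^+ k.+1 != 0.
  by rewrite subr_norm_neq0 // normrX exprn_ilt1.
(* This puts the arguments [c q^n], [n >= 1], of F in the unit disc. For [q = 0] the bound [hc] is
   vacuous, but the product is 0. *)
have cq1 k : `|c * q ^+ k.+1| < 1.
  have [->|q0] := eqVneq q 0; first by rewrite expr0n mulr0 normr0.
  have cq : `|c * q| < 1.
    by rewrite normrM -ltr_pdivlMr ?normr_gt0 // hc.
  rewrite exprS mulrA normrM (le_lt_trans _ cq) // ler_piMr // normrX.
  by rewrite exprn_ile1 // ltW.
(* For [k >= 1] the modulus bound applies; for [k = 0] this says [c != 1], which is [hcq] at 0. *)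
have nzc k : 1 - c * q ^+ k != 0.
  case: k => [|k]; last by rewrite subr_norm_neq0.
  have := hcq 0%N isT; rewrite expr0 invr1 mulr1 oner_eq0 subr_eq0 eq_sym.
  exact.
have nzP := qpochqq_neq0 _ q nzq.
set P := qpoch q q N.
have -> : c / ((1 - c) ^+ 2 * P) * (P / qpoch q (c * q) N - 1) +
    1 / qpoch q c N.+1 * (\sum_(1 <= n < N.+1)
      qpoch q (c * q) n / qpoch q q n * (q ^+ n / (1 - q ^+ n))) =
    P^-1 * - gsum _ q c (qharm _ q) N.
  rewrite gsum_qharm // -/P [RHS]mulrDr; congr (_ + _).
    by rewrite [RHS]mulrA; congr (_ * _); rewrite invfM [LHS]mulrA mulrC.
  by rewrite !mulrA mulVf ?nzP.
rewrite mul1r.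
have -> : \sum_(1 <= n < N.+1)
      qbinom q N n * (q ^+ (n * (n + 1)) / (qpoch q q n * (1 - q ^+ n))) *
        fineF q (q ^+ N) (q ^+ n) (c * q ^+ n) =
    P^-1 * - gsum _ q c (fun k => \sum_(1 <= n < k.+1) q ^+ n / (1 - q ^+ n)) N.
  rewrite -double_sum_gsum // mulr_sumr; apply: eq_big_nat => -[//|n] /andP[_ lenN].
  rewrite qbinom_gauss // fineF_gauss // addn1 -/P.
  set S := \sum_(_ <= _ < _) _.
  move: (nzP n.+1) (nzq n) (nzP N); rewrite -/P => n1 n2 n3.
  move: (qpoch q q n.+1) n1 => Q n1.
  by field; rewrite n1 n2 n3.
(* With [1 / (q)_N] removed, [qharmE] and linearity of [gsum] in its weight remain. *)
rewrite -mulrDr; congr (_ * _).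
have -> : \sum_(1 <= n < N.+1) qbinom q N n *
      ((-1) ^+ (n - 1) * n%:R * q ^+ (n * (n + 1) %/ 2) / (1 - c * q ^+ n)) =
    - gsum _ q c (fun k => k%:R) N.
  (* The weight [k%:R] kills the term at 0, so the sum may start at 1. *)
  rewrite /gsum -sumrN [RHS]big_ltn // mulr0 mul0r mulr0 oppr0 add0r.
  apply: eq_big_nat => -[//|n] /andP[_ lenN].
  rewrite qbinom_gauss // addn1 muln_bin2 mulKn // subn1 /=.
  by rewrite [(-1) ^+ n.+1]exprS !mulN1r !mulNr mulrN opprK (mulrAC ((-1) ^+ n)).
rewrite -opprD /gsum -big_split /=; congr (- _); apply: eq_bigr => k _.
by rewrite qharmE // [in RHS]mulrDr mulrDl mulrDr.
Qed.
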